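(* For a generic finite $N$-dimensional unitary system with discrete time steps, with single-step unitaries $U(k+1,k)$ ($k\ge1$) and initial unit vector $\psi\in\mathbb C^N$, the quantum vector pre-measure $\mu_{\mathsf v}:\mathfrak A\to\mathcal H$ is not of bounded variation. Here ''generic'' means the following. If the evolution is time independent, $U(k+1,k)=U$ for all $k$: defining $\zeta_j\ge 0$ by $\sum_{i=1}^N|U_{ij}|=1+\zeta_j$, one has $\zeta_j>0$ for all $j=1,\dots,N$. If the evolution is time dependent: defining $\zeta_j(r)\ge0$ by $\sum_{i=1}^N|U_{ij}(r,r-1)|=1+\zeta_j(r)$ and $\zeta_r=\min_j\zeta_j(r)$ for $r\ge2$, one has $\zeta_r>0$ for all $r$ and $\sum_{r\ge2}\zeta_r=\infty$.
   Context: Finite unitary system: times $t=1,2,3,\dots$; for each $k\ge1$ an $N\times N$ unitary matrix $U(k+1,k)$ with entries $U_{ij}(k+1,k)$ in a fixed orthonormal basis $e_1,\dots,e_N$ of $\mathbb C^N$; a unit vector $\psi\in\mathbb C^N$ with $\psi(s)=\langle e_s,\psi\rangle$. $\Omega$ is the set of infinite strings $(s_1,s_2,\dots)$ with $s_i\in\{1,\dots,N\}$. For a finite string $\gamma=(s_1,\dots,s_m)$, $\mathrm{cyl}(\gamma)\subset\Omega$ is the set of infinite strings whose first $m$ entries are $s_1,\dots,s_m$. $\mathfrak A$ is the algebra generated by the cylinder sets; each of its elements is a finite disjoint union of cylinder sets of strings of one common length. The decoherence functional $D:\mathfrak A\times\mathfrak A\to\mathbb C$ is determined by finite bi-additivity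 and, for strings $\gamma=(s_1,\dots,s_m)$, $\gamma'=(s'_1,\dots,s'_m)$ of equal length, $$D(\mathrm{cyl}(\gamma),\mathrm{cyl}(\gamma'))=A^*(\gamma)A(\gamma')\,\delta_{s_ms'_m},\qquad A(\gamma)=U_{s_ms_{m-1}}(m,m-1)\cdots U_{s_2s_1}(2,1)\,\psi(s_1).$$ Histories Hilbert space: let $V$ be the space of finitely supported functions $u:\mathfrak A\to\mathbb C$ with $\langle u,v\rangle_V=\sum_{\alpha,\beta}u^*(\alpha)v(\beta)D(\alpha,\beta)$; $\mathcal H$ is the Hilbert space of Cauchy sequences in $V$ modulo $\{u_i\}\sim\{v_i\}$ iff $\|u_i-v_i\|_V\to0$. The quantum vector pre-measure is $\mu_{\mathsf v}(\alpha)=[\chi_\alpha]\in\mathcal H$, with $\chi_\alpha\in V$ equal to $1$ at $\alpha$ and $0$ elsewhere; it is finitely additive and $\langle\mu_{\mathsf v}(\alpha),\mu_{\mathsf v}(\beta)\rangle=D(\alpha,\beta)$. Total variation: $|\mu_{\mathsf v}|(\alpha)=\sup\sum_\rho\|\mu_{\mathsf v}(\alpha_\rho)\|$ over finite partitions $\{\alpha_\rho\}\subset\mathfrak A$ of $\alpha$; $\mu_{\mathsf v}$ is of bounded variation if $|\mu_{\mathsf v}|(\alpha)<\infty$ for all $\alpha\in\mathfrak A$. *)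

(* Defs.v *)
From HB Require Import structures.
From mathcomp Require Import all_boot all_order all_algebra.
From mathcomp Require Import finmap generic_quotient.
From mathcomp Require Import all_classical all_reals all_analysis.
From mathcomp Require Import complex spectral sesquilinear.
Set Implicit Arguments.
Unset Strict Implicit.
Unset Printing Implicit Defensive.
Import Order.TTheory GRing.Theory Num.Theory.
Import numFieldNormedType.Exports.
Local Open Scope ring_scope.
Local Open Scope classical_set_scope.
Local Open Scope quotient_scope.

(* Strings. The entry s_k of a string is stored at index k.-1, and finite     *)
(* strings are non-empty: a string of length m.+1 is an m.+1-tuple.           *)

Definition history (N : nat) := nat -> 'I_N.

Definition cyl (N m : nat) (g : m.-tuple 'I_N) : set (history N) :=
  [set w | forall i : 'I_m, w i = tnth g i].

Definition setalgebra (T : Type) (G : set (set T)) :=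
  [/\ G setT, setU_closed G & setC_closed G].

Definition events (N : nat) : set (set (history N)) :=
  smallest (@setalgebra (history N))
    [set a | exists m (g : m.+1.-tuple 'I_N), a = cyl g].

Definition event (N : nat) := {a : set (history N) | `[< events a >]}.

Definition of_level (N m : nat) (a : set (history N)) :=
  exists S : {set m.+1.-tuple 'I_N}, a = \bigcup_(g in [set` S]) cyl g.

Section Events.
Variable N : nat.
Implicit Types (a b : set (history N)) (m n : nat).

Definition depends m a :=
  forall w w' : history N, (forall k, (k < m)%N -> w k = w' k) -> a w -> a w'.

Definition prefix_of (w : history N) m : m.-tuple 'I_N := [tuple w i | i < m].

Lemma cyl_prefix_of w m : cyl (prefix_of w m) w.
Proof. by move=> i; rewrite tnth_mktuple. Qed.

Lemma cylP m (g : m.-tuple 'I_N) w : cyl g w <-> g = prefix_of w m.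
Proof.
split=> [gw|->]; last exact: cyl_prefix_of.
by apply: eq_from_tnth => i; rewrite tnth_mktuple gw.
Qed.

Lemma cyl_nonempty m (g : m.+1.-tuple 'I_N) : cyl g !=set0.
Proof.
exists (fun k => nth (tnth g ord0) g k) => i /=.
exact/esym/tnth_nth.
Qed.

Lemma dependsP m a : depends m a <->
  forall w, a w <-> cyl (prefix_of w m) `<=` a.
Proof.
split=> [da w|ha w w' ww' /ha]; last first.
  by apply => i; rewrite tnth_mktuple; apply/esym/ww'.
split=> [aw w' gw'|]; last by apply; exact: cyl_prefix_of.
apply: da aw => k km.
by have := gw' (Ordinal km); rewrite tnth_mktuple.
Qed.

Lemma depends_cyl m (g : m.-tuple 'I_N) : depends m (cyl g).
Proof.
move=> w w' ww' gw i; rewrite -gw; apply/esym/ww'; exact: ltn_ord.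
Qed.

Lemma depends_le m n a : (m <= n)%N -> depends m a -> depends n a.
Proof.
move=> mn da w w' ww'; apply: da => k km; apply: ww'; exact: leq_trans km mn.
Qed.

Lemma dependsC m a : depends m a -> depends m (~` a).
Proof.
move=> da w w' ww' naw aw'; apply: naw; apply: da aw' => k km.
by apply/esym/ww'.
Qed.

Lemma dependsU m a b : depends m a -> depends m b -> depends m (a `|` b).
Proof.
by move=> da db w w' ww' [aw|bw]; [left; apply: da aw|right; apply: db bw].
Qed.

Lemma of_levelP m a : of_level m a <-> depends m.+1 a.
Proof.
split=> [[S ->] w w' ww' [g Sg gw]|da].
  by exists g => //; apply: depends_cyl gw.
exists [set g | `[< cyl g `<=` a >]]%SET; apply/seteqP; split=> w.
  move=> aw; exists (prefix_of w m.+1); last exact: cyl_prefix_of.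
  by rewrite /= inE; apply/asboolP/((iffLR (dependsP _ _) da) w).
by move=> [g]; rewrite /= inE => /asboolP ga /ga.
Qed.

Lemma events_algebra : setalgebra (@events N).
Proof.
split.
- by move=> G [[]].
- by move=> a b ea eb G HG; case: (HG) => -[_ GU _] _; apply: GU; [exact: ea|exact: eb].
- by move=> a ea G HG; case: (HG) => -[_ _ GC] _; apply: GC; exact: ea.
Qed.

Lemma events_cyl m (g : m.+1.-tuple 'I_N) : events (cyl g).
Proof. by move=> G [_]; apply; exists m, g. Qed.

(* Every event is a finite (disjoint) union of cylinders of a common length. *)
Lemma eventsP a : events a <-> exists m, of_level m a.
Proof.
split=> [|[m [S ->]]].
  move=> ea; apply: (ea [set a | exists m, of_level m a]); split.
    split.
    - by exists 0%N; apply/of_levelP.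
    - move=> x y [m /of_levelP dx] [n /of_levelP dy]; exists (maxn m n).
      apply/of_levelP/dependsU; [apply: depends_le dx|apply: depends_le dy];
      by rewrite ltnS (leq_maxl, leq_maxr).
    - by move=> x [m /of_levelP dx]; exists m; apply/of_levelP/dependsC.
  by move=> _ [m [g ->]]; exists m; apply/of_levelP/depends_cyl.
have [aT aU aC] := events_algebra.
have e0 : events (set0 : set (history N)) by rewrite -setCT; exact: aC.
have -> : [set` S] = [set` enum S] by apply/seteqP; split=> g /=; rewrite mem_enum.
by rewrite bigcup_seq; elim/big_ind: _ => // g _; exact: events_cyl.
Qed.

End Events.

Record unitary_system (R : realType) (N : nat) := UnitarySystem {
  (* [step k] is U(k+1,k); the value [step 0] is irrelevant. *)
  step : nat -> 'M[R[i]]_N;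
  init : 'cV[R[i]]_N;
  step_unitary : forall k, (1 <= k)%N -> step k \is unitarymx;
  init_unit : \sum_s `|init s 0| ^+ 2 = 1 }.

Section Decoherence.
Variables (R : realType) (N : nat) (S : unitary_system R N).
Local Notation C := R[i].

(* With g = (s_1, ..., s_(m+1)), the i-th factor below, counted from 0, is    *)
(* the entry (s_(i+2), s_(i+1)) of U(i+2,i+1).                                *)
Definition amplitude m (g : m.+1.-tuple 'I_N) : C :=
  (\prod_(i < m) step S i.+1 (tnth g (lift ord0 i)) (tnth g (widen_ord (leqnSn m) i)))
  * init S (tnth g ord0) 0.

Definition dec_level m (a b : set (history N)) : C :=
  \sum_(g : m.+1.-tuple 'I_N | `[< cyl g `<=` a >])
   \sum_(h : m.+1.-tuple 'I_N | `[< cyl h `<=` b >])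
     (amplitude g)^* * amplitude h * (tnth g ord_max == tnth h ord_max)%:R.

(* The value of [dec_level m] does not depend on the common level m           *)
(* (see [decE]); D is then characterized by [dec_cyl], [decDl], [decDr].      *)
Definition decoherence (a b : event N) : C :=
  dec_level (xget 0%N [set m | of_level m (val a) /\ of_level m (val b)])
    (val a) (val b).

Definition ampv m (a : set (history N)) : 'rV[C]_N :=
  \sum_(g : m.+1.-tuple 'I_N | `[< cyl g `<=` a >])
     amplitude g *: delta_mx 0 (tnth g ord_max).

Lemma dotmxZ (x y : C) (u v : 'rV[C]_N) :
  dotmx (x *: u) (y *: v) = x * y^* * dotmx u v.
Proof. by rewrite linearZl_LR linearZr_LR /= mulrA. Qed.

Lemma dotmx_delta (s t : 'I_N) :
  dotmx (delta_mx 0 s : 'rV[C]_N) (delta_mx 0 t) = (s == t)%:R.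
Proof.
rewrite dotmxE mxE (bigD1 s) //= big1 ?addr0 => [|k ks].
  by rewrite !mxE !eqxx /= mul1r rmorph_nat.
by rewrite !mxE (negbTE ks) andbF mul0r.
Qed.

Lemma dec_levelE m a b : dec_level m a b = dotmx (ampv m b) (ampv m a).
Proof.
rewrite /ampv linear_sumr /=; apply: eq_bigr => g _.
rewrite linear_sumlz /=; apply: eq_bigr => h _.
rewrite dotmxZ dotmx_delta [_ * amplitude h]mulrC.
by rewrite [tnth h _ == _]eq_sym.
Qed.

Definition initial m (g : m.+2.-tuple 'I_N) : m.+1.-tuple 'I_N :=
  [tuple tnth g (widen_ord (leqnSn m.+1) i) | i < m.+1].
Definition extend m (g : m.+1.-tuple 'I_N) (s : 'I_N) : m.+2.-tuple 'I_N :=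
  [tuple of rcons g s].

Lemma tnth_extend_widen m (g : m.+1.-tuple 'I_N) s (i : 'I_m.+1) :
  tnth (extend g s) (widen_ord (leqnSn m.+1) i) = tnth g i.
Proof. by rewrite !(tnth_nth s) /= nth_rcons size_tuple ltn_ord. Qed.

Lemma tnth_extend_max m (g : m.+1.-tuple 'I_N) s :
  tnth (extend g s) ord_max = s.
Proof. by rewrite (tnth_nth s) /= nth_rcons size_tuple ltnn eqxx. Qed.

Lemma initial_extend m (g : m.+1.-tuple 'I_N) s : initial (extend g s) = g.
Proof. by apply: eq_from_tnth => i; rewrite tnth_mktuple tnth_extend_widen. Qed.

Lemma extend_initial m (g : m.+2.-tuple 'I_N) :
  extend (initial g) (tnth g ord_max) = g.
Proof.
apply: eq_from_tnth => i; case: (ltnP i m.+1) => im.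
  have -> : i = widen_ord (leqnSn m.+1) (Ordinal im) by apply: val_inj.
  by rewrite tnth_extend_widen tnth_mktuple.
have -> : i = ord_max.
  by apply: val_inj => /=; apply/eqP; rewrite eqn_leq im -ltnS ltn_ord.
by rewrite tnth_extend_max.
Qed.

Lemma amplitude_extend m (g : m.+1.-tuple 'I_N) s :
  amplitude (extend g s) = step S m.+1 s (tnth g ord_max) * amplitude g.
Proof.
rewrite /amplitude big_ord_recr /= tnth_extend_widen.
have -> : lift ord0 (ord_max : 'I_m.+1) = ord_max by exact: val_inj.
have w0 : ord0 = widen_ord (leqnSn m.+1) ord0 by exact: val_inj.
rewrite tnth_extend_max {2}w0 tnth_extend_widen [X in X * init _ _ _]mulrC -mulrA.
congr (_ * (_ * _)); apply: eq_bigr => i _.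
have -> : lift ord0 (widen_ord (leqnSn m) i) =
          widen_ord (leqnSn m.+1) (lift ord0 i) by exact: val_inj.
by rewrite !tnth_extend_widen.
Qed.

Lemma cyl_extend m (g : m.+1.-tuple 'I_N) s (a : set (history N)) :
  depends m.+1 a -> cyl (extend g s) `<=` a <-> cyl g `<=` a.
Proof.
move=> da; split=> h w gw.
  have [w' gw'] := cyl_nonempty (extend g s).
  apply: da (h w' gw') => k km.
  have := gw' (widen_ord (leqnSn m.+1) (Ordinal km)).
  by rewrite tnth_extend_widen /= => ->; rewrite -gw.
apply: h => i; rewrite -(tnth_extend_widen g s).
by rewrite -gw.
Qed.

Lemma ampvS m a : depends m.+1 a -> ampv m.+1 a = ampv m a *m (step S m.+1)^T.
Proof.
move=> da; rewrite /ampv mulmx_suml.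
under [RHS]eq_bigr => g _ do rewrite -scalemxAl -rowE.
rewrite (reindex (fun p : m.+1.-tuple 'I_N * 'I_N => extend p.1 p.2)) /=; last first.
  exists (fun g => (initial g, tnth g ord_max)) => [[g s] _|g _] /=.
    by rewrite initial_extend tnth_extend_max.
  exact: extend_initial.
rewrite (eq_bigl (fun p => `[< cyl p.1 `<=` a >] && true)); last first.
  by move=> [g s] /=; rewrite andbT; apply/asbool_equiv_eq/cyl_extend.
rewrite -(pair_big (fun g => `[< cyl g `<=` a >]) xpredT
  (fun g s => amplitude (extend g s) *: delta_mx 0 (tnth (extend g s) ord_max))) /=.
apply: eq_bigr => g _; rewrite [X in _ *: X]row_sum_delta scaler_sumr.
apply: eq_bigr => s _; rewrite amplitude_extend tnth_extend_max !mxE scalerA.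
by rewrite mulrC.
Qed.

Lemma dec_levelS m a b : depends m.+1 a -> depends m.+1 b ->
  dec_level m.+1 a b = dec_level m a b.
Proof.
move=> da db; rewrite !dec_levelE !ampvS // !dotmxE trmx_mul map_mxM /=.
by rewrite mulmxA mulmxtVK // trmx_unitary; exact: step_unitary.
Qed.

Lemma dec_levelD m n a b : depends m.+1 a -> depends m.+1 b ->
  dec_level (n + m) a b = dec_level m a b.
Proof.
move=> da db; elim: n => // n <-; rewrite addSn dec_levelS //.
  by apply: depends_le da; rewrite ltnS leq_addl.
by apply: depends_le db; rewrite ltnS leq_addl.
Qed.

Lemma dec_level_le m n a b : (m <= n)%N -> depends m.+1 a -> depends m.+1 b ->
  dec_level n a b = dec_level m a b.
Proof. by move=> /subnK <-; exact: dec_levelD. Qed.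

Lemma event_depends (a : event N) : exists m, depends m.+1 (val a).
Proof.
by have /asboolP/eventsP[m /of_levelP] := valP a; exists m.
Qed.

Lemma decE m (a b : event N) : depends m.+1 (val a) -> depends m.+1 (val b) ->
  decoherence a b = dec_level m (val a) (val b).
Proof.
move=> da db; rewrite /decoherence; case: xgetP => [k _ [/of_levelP ka /of_levelP kb]|].
  by rewrite -(dec_level_le (leq_maxl k m)) // (dec_level_le (leq_maxr k m)).
by move=> /(_ m)[]; split; apply/of_levelP.
Qed.

Lemma ampvU m a b : depends m.+1 a -> depends m.+1 b -> a `&` b = set0 ->
  ampv m (a `|` b) = ampv m a + ampv m b.
Proof.
move=> da db ab0; rewrite /ampv (bigID (fun g => `[< cyl g `<=` a >])) /=.
have sub (c : set (history N)) (g : m.+1.-tuple 'I_N) w : depends m.+1 c ->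
    cyl g w -> c w -> cyl g `<=` c.
  by move=> dc /cylP -> /(iffLR (dependsP _ _) dc w).
have disj (g : m.+1.-tuple 'I_N) w : cyl g w -> cyl g `<=` a -> cyl g `<=` b -> False.
  by move=> gw /(_ _ gw) aw /(_ _ gw) bw; have : (a `&` b) w by []; rewrite ab0.
congr (_ + _); apply: eq_bigl => g.
  rewrite -asbool_and; apply/asbool_equiv_eq; split=> [[]//|ga].
  by split=> // w /ga; left.
have [w gw] := cyl_nonempty g.
rewrite -asbool_neg -asbool_and; apply/asbool_equiv_eq; split=> [[gab nga]|gb].
  case: (gab w gw) => [aw|bw]; last exact: sub gw bw.
  by case: nga; exact: sub gw aw.
by split=> [v /gb|ga]; [right|exact: disj gw ga gb].
Qed.

Lemma decDl (a b c d : event N) : val a `&` val b = set0 ->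
  val c = val a `|` val b -> decoherence c d = decoherence a d + decoherence b d.
Proof.
move=> ab0 cE; have [[k ka] [l lb] [m md]] := And3 (event_depends a) (event_depends b) (event_depends d).
pose n := maxn k (maxn l m).
have na : depends n.+1 (val a) by apply: depends_le ka; rewrite ltnS leq_maxl.
have nb : depends n.+1 (val b) by apply: depends_le lb; rewrite ltnS !leq_max leqnn orbT.
have nd : depends n.+1 (val d) by apply: depends_le md; rewrite ltnS !leq_max leqnn !orbT.
rewrite !(decE (m := n)) ?cE //; last exact: dependsU.
by rewrite !dec_levelE ampvU // linearDr.
Qed.

Lemma decC (a b : event N) : decoherence b a = (decoherence a b)^*.
Proof.
have [[k ka] [l lb]] := conj (event_depends a) (event_depends b).
have na : depends (maxn k l).+1 (val a) by apply: depends_le ka; rewrite ltnS leq_maxl.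
have nb : depends (maxn k l).+1 (val b) by apply: depends_le lb; rewrite ltnS leq_maxr.
rewrite !(decE (m := maxn k l)) // !dec_levelE.
by rewrite [LHS](hermC (@dotmx _ _)) /= expr0 mul1r.
Qed.

Lemma decDr (a b c d : event N) : val a `&` val b = set0 ->
  val c = val a `|` val b -> decoherence d c = decoherence d a + decoherence d b.
Proof.
by move=> ab0 cE; rewrite decC (decDl _ ab0 cE) rmorphD /= -!decC.
Qed.

Lemma ampv_cyl m (g : m.+1.-tuple 'I_N) :
  ampv m (cyl g) = amplitude g *: delta_mx 0 (tnth g ord_max).
Proof.
rewrite /ampv (big_pred1 g) // => h; apply/asboolP/eqP => [hg|-> //].
have [w hw] := cyl_nonempty h.
by rewrite (iffLR (cylP _ _) hw) (iffLR (cylP _ _) (hg _ hw)).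
Qed.

Definition cyl_event m (g : m.+1.-tuple 'I_N) : event N :=
  Sub (cyl g) (asboolT (@events_cyl _ _ g)).

Lemma dec_cyl m (g h : m.+1.-tuple 'I_N) :
  decoherence (cyl_event g) (cyl_event h) =
  (amplitude g)^* * amplitude h * (tnth g ord_max == tnth h ord_max)%:R.
Proof.
rewrite (decE (m := m)); try exact: depends_cyl.
rewrite dec_levelE /= !ampv_cyl dotmxZ dotmx_delta.
by rewrite [amplitude h * _]mulrC [tnth h _ == _]eq_sym.
Qed.
End Decoherence.

Definition finitely_supported (R : realType) (N : nat) :
  {pred event N -> R[i]} := fun u => `[< finite_set [set a | u a != 0] >].

Record fsupp (R : realType) (N : nat) := Fsupp {
  fsupp_fun :> event N -> R[i];
  fsupp_finite : fsupp_fun \in @finitely_supported R N }.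

Section FiniteSupport.
Variables (R : realType) (N : nat).

HB.instance Definition _ := [isSub for @fsupp_fun R N].
HB.instance Definition _ := [Choice of fsupp R N by <:].

Fact finitely_supported_submod : submod_closed (@finitely_supported R N).
Proof.
split=> [|c u v /asboolP fu /asboolP fv].
  by apply/asboolP; rewrite (_ : mkset _ = set0) //; apply/seteqP; split=> a //=; rewrite eqxx.
apply/asboolP; apply: (@sub_finite_set _ _ ([set a | u a != 0] `|` [set a | v a != 0])).
  move=> a /=; apply: contraNP => /not_orP[/negP]; rewrite negbK => /eqP ua /negP.
  rewrite negbK => /eqP va; apply/eqP.
  by rewrite -[LHS]/(c * u a + v a) ua va mulr0 addr0.
by rewrite finite_setU.
Qed.
HB.instance Definition _ :=
  GRing.isSubmodClosed.Build R[i] (event N -> R[i]) (@finitely_supported R N) finitely_supported_submod.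
HB.instance Definition _ :=
  [SubChoice_isSubLmodule of fsupp R N by <:].

Fact chi_finite (a : event N) :
  (fun b => (b == a)%:R) \in @finitely_supported R N.
Proof.
apply/asboolP; apply: (@sub_finite_set _ _ [set a]) => // b /=.
by have [->//|_] := eqVneq b a; rewrite eqxx.
Qed.

Definition chi (a : event N) : fsupp R N := Fsupp (chi_finite a).

End FiniteSupport.

Section HistoriesHilbertSpace.
Variables (R : realType) (N : nat) (S : unitary_system R N).
Local Notation C := R[i].
Local Notation V := (fsupp R N).

(* Conjugate-linear in the first argument. *)
Definition vdot (u v : V) : C :=
  \sum_(a \in [set: event N]) \sum_(b \in [set: event N]) (u a)^* * v b * decoherence S a b.

Definition vnorm (u : V) : R := Num.sqrt (complex.Re (vdot u u)).

Definition vcauchy (u : nat -> V) := forall e : R, 0 < e ->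
  exists n, forall i j, (n <= i)%N -> (n <= j)%N -> vnorm (u i - u j) < e.

Record cauchy_seq := CauchySeq {
  cauchy_fun :> nat -> V;
  cauchy_funP : `[< vcauchy cauchy_fun >] }.

HB.instance Definition _ := [isSub for cauchy_fun].
HB.instance Definition _ := [Choice of cauchy_seq by <:].

Definition ampl_fsupp m (u : V) : 'rV[C]_N :=
  \sum_(a \in [set: event N]) u a *: ampv S m (val a).

Definition fset_supp (u : V) : {fset event N} := fset_set [set a | u a != 0].

Lemma fset_suppP u a : a \notin fset_supp u -> u a = 0.
Proof.
have fu : finite_set [set a | u a != 0] by apply/asboolP; exact: fsupp_finite.
by rewrite in_fset_set // notin_setE /= => /negP; rewrite negbK => /eqP.
Qed.

Lemma ampl_fsuppE m (u : V) (X : {fset event N}) : (forall a, a \notin X -> u a = 0) ->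
  ampl_fsupp m u = \sum_(a <- X) u a *: ampv S m (val a).
Proof. by move=> uX; apply: fsbigTE => a /uX ->; rewrite scale0r. Qed.

Lemma vdotE (u v : V) (X : {fset event N}) :
    (forall a, a \notin X -> u a = 0) -> (forall a, a \notin X -> v a = 0) ->
  vdot u v = \sum_(a <- X) \sum_(b <- X) (u a)^* * v b * decoherence S a b.
Proof.
move=> uX vX; have H a : \sum_(b \in [set: event N]) (u a)^* * v b * decoherence S a b
    = \sum_(b <- X) (u a)^* * v b * decoherence S a b.
  by apply: fsbigTE => b /vX ->; rewrite mulr0 mul0r.
rewrite /vdot (fsbigTE X) => [|a /uX ua]; first by apply: eq_bigr => a _; rewrite H.
by rewrite H big1 // => b _; rewrite ua conjC0 !mul0r.
Qed.

Lemma common_depth (X : {fset event N}) :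
  exists m, forall n (a : event N), (m <= n)%N -> a \in X -> depends n.+1 (val a).
Proof.
pose d (a : event N) := projT1 (cid (event_depends a)).
exists (\max_(a <- X) d a)%N => n a mn aX.
apply: (@depends_le _ (d a).+1); last exact: (projT2 (cid (event_depends a))).
by rewrite ltnS; apply: leq_trans mn; exact: leq_bigmax_seq.
Qed.

Lemma vdot_ampl (X : {fset event N}) : exists m, forall n (u v : V), (m <= n)%N ->
    (forall a, a \notin X -> u a = 0) -> (forall a, a \notin X -> v a = 0) ->
  vdot u v = dotmx (ampl_fsupp n v) (ampl_fsupp n u).
Proof.
have [m mX] := common_depth X; exists m => n u v mn uX vX.
rewrite (vdotE uX vX) (ampl_fsuppE n uX) (ampl_fsuppE n vX) linear_sumr /=.
rewrite big_seq [RHS]big_seq; apply: eq_bigr => a aX.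
rewrite linear_sumlz /= big_seq [RHS]big_seq; apply: eq_bigr => b bX.
rewrite dotmxZ -dec_levelE -decE; [by rewrite [v b * _]mulrC|exact: mX..].
Qed.

Lemma ampl_fsuppD m (u v : V) : ampl_fsupp m (u + v) = ampl_fsupp m u + ampl_fsupp m v.
Proof.
pose X := (fset_supp u `|` fset_supp v)%fset.
have uX a : a \notin X -> u a = 0.
  by rewrite in_fsetU negb_or => /andP[/fset_suppP].
have vX a : a \notin X -> v a = 0.
  by rewrite in_fsetU negb_or => /andP[_ /fset_suppP].
rewrite (ampl_fsuppE _ uX) (ampl_fsuppE _ vX) (ampl_fsuppE _ (X := X)) -?big_split /=.
  by apply: eq_bigr => a _; rewrite -scalerDl.
by move=> a aX; rewrite -[LHS]/(u a + v a) uX // vX // addr0.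
Qed.

Lemma ampl_fsuppN m (u : V) : ampl_fsupp m (- u) = - ampl_fsupp m u.
Proof.
have uX := @fset_suppP u.
rewrite (ampl_fsuppE _ uX) (ampl_fsuppE _ (X := fset_supp u)); last first.
  by move=> a aX; rewrite -[LHS]/(- u a) uX // oppr0.
by rewrite -sumrN; apply: eq_bigr => a _; rewrite -scaleNr.
Qed.

Lemma vdot_level (u v w : V) : exists m,
  [/\ vdot u u = dotmx (ampl_fsupp m u) (ampl_fsupp m u),
      vdot v v = dotmx (ampl_fsupp m v) (ampl_fsupp m v) &
      [/\ vdot u v = dotmx (ampl_fsupp m v) (ampl_fsupp m u),
      vdot v u = dotmx (ampl_fsupp m u) (ampl_fsupp m v),
      vdot u w = dotmx (ampl_fsupp m w) (ampl_fsupp m u),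
      vdot v w = dotmx (ampl_fsupp m w) (ampl_fsupp m v) &
      vdot (u + v) (u + v) = dotmx (ampl_fsupp m (u + v)) (ampl_fsupp m (u + v)) /\
      vdot (u + v) w = dotmx (ampl_fsupp m w) (ampl_fsupp m (u + v))]].
Proof.
pose X := (fset_supp u `|` fset_supp v `|` fset_supp w)%fset.
have uX a : a \notin X -> u a = 0.
  by rewrite !in_fsetU !negb_or => /andP[/andP[/fset_suppP]].
have vX a : a \notin X -> v a = 0.
  by rewrite !in_fsetU !negb_or => /andP[/andP[_ /fset_suppP]].
have wX a : a \notin X -> w a = 0.
  by rewrite !in_fsetU !negb_or => /andP[_ /fset_suppP].
have uvX a : a \notin X -> (u + v) a = 0.
  by move=> aX; rewrite -[LHS]/(u a + v a) uX // vX // addr0.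
have [m H] := vdot_ampl X; exists m.
by rewrite !(H m).
Qed.

Lemma vdotC u v : vdot v u = (vdot u v)^*.
Proof.
have [m [_ _ [-> -> _ _ _]]] := vdot_level u v 0.
by rewrite [LHS](hermC (@dotmx _ _)) /= expr0 mul1r.
Qed.

Lemma vdotDl u v w : vdot (u + v) w = vdot u w + vdot v w.
Proof.
have [m [_ _ [_ _ -> -> [_ ->]]]] := vdot_level u v w.
by rewrite ampl_fsuppD linearDr.
Qed.

Lemma vdot_ge0 u : 0 <= vdot u u.
Proof. by have [m [-> _ _]] := vdot_level u 0 0; exact: (dnorm_ge0 (@dotmx _ _)). Qed.

Lemma vnormE u : vdot u u = ((vnorm u) ^+ 2)%:C%C.
Proof.
rewrite sqr_sqrtr; first by rewrite RRe_real // ger0_real // vdot_ge0.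
by have := vdot_ge0 u; case: (vdot u u) => x y; rewrite lecE /= => /andP[].
Qed.

Lemma vnorm_ge0 u : 0 <= vnorm u.
Proof. exact: sqrtr_ge0. Qed.

Lemma sqrtC_vdot u : sqrtC (vdot u u) = (vnorm u)%:C%C.
Proof. by rewrite vnormE rmorphXn sqrCK // ler0c vnorm_ge0. Qed.

Lemma vdot_le u v : `|vdot u v| <= (vnorm u * vnorm v)%:C%C.
Proof.
rewrite rmorphM /= -(sqrtC_vdot u) -(sqrtC_vdot v) [leRHS]mulrC.
have [m [-> -> [-> _ _ _ _]]] := vdot_level u v 0.
exact: (CauchySchwarz_sqrt (@dotmx _ _) (ampl_fsupp m v) (ampl_fsupp m u)).1.
Qed.

Lemma vnormD u v : vnorm (u + v) <= vnorm u + vnorm v.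
Proof.
rewrite -lecR rmorphD /= -(sqrtC_vdot u) -(sqrtC_vdot v) -(sqrtC_vdot (u + v)).
have [m [-> -> [_ _ _ _ [-> _]]]] := vdot_level u v 0.
rewrite ampl_fsuppD.
exact: (triangle_lerif (@dotmx _ _) (ampl_fsupp m u) (ampl_fsupp m v)).1.
Qed.

Lemma vnormN u : vnorm (- u) = vnorm u.
Proof.
rewrite /vnorm; have [m H] := vdot_ampl (fset_supp u).
have uX := @fset_suppP u.
have nX a : a \notin fset_supp u -> (- u) a = 0.
  by move=> aX; rewrite -[LHS]/(- u a) uX // oppr0.
have Hu := H m u u (leqnn m) uX uX; have Hn := H m (- u) (- u) (leqnn m) nX nX.
congr (Num.sqrt (complex.Re _)); rewrite Hn ampl_fsuppN.
by apply: etrans (esym Hu); exact: (hnormN (@dotmx _ _)).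
Qed.

Lemma vnorm0 : vnorm 0 = 0.
Proof.
by rewrite /vnorm; have := vdotDl 0 0 0; rewrite addr0 => /eqP;
  rewrite -subr_eq subrr => /eqP <-; rewrite sqrtr0.
Qed.

Definition cauchy_eqv (u v : cauchy_seq) : bool :=
  `[< (fun i => vnorm (u i - v i)) @ \oo --> (0 : R) >].

Lemma cauchy_eqv_refl : reflexive cauchy_eqv.
Proof.
move=> u; apply/asboolP; rewrite (_ : (fun _ => _) = fun=> 0); first exact: cvg_cst.
by apply/funext => i; rewrite subrr vnorm0.
Qed.

Lemma cauchy_eqv_sym : symmetric cauchy_eqv.
Proof.
move=> u v; rewrite /cauchy_eqv.
suff -> : (fun i => vnorm (u i - v i)) = (fun i => vnorm (v i - u i)) by [].
by apply/funext => i; rewrite -vnormN opprB.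
Qed.

Lemma cauchy_eqv_trans : transitive cauchy_eqv.
Proof.
move=> v u w /asboolP uv /asboolP vw; apply/asboolP.
apply: (@squeeze_cvgr _ _ _ _ (fun=> 0)
  (fun i => vnorm (u i - v i) + vnorm (v i - w i))).
- near=> i; rewrite vnorm_ge0 /= (le_trans _ (vnormD _ _)) //.
  by rewrite addrA subrK.
- exact: cvg_cst.
- by rewrite -[X in _ --> X](addr0 (0 : R)); exact: cvgD uv vw.
Unshelve. all: by end_near. Qed.

Canonical cauchy_eqv_equiv :=
  EquivRel cauchy_eqv cauchy_eqv_refl cauchy_eqv_sym cauchy_eqv_trans.

Definition hspace := {eq_quot cauchy_eqv}.

HB.instance Definition _ := Choice.on hspace.
HB.instance Definition _ := EqQuotient.on hspace.

(* The limits defining the inner product do not depend on representatives;    *)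
(* see [hdot_mu_v] for its values on the vector measure.                      *)
Definition hdot (x y : hspace) : C :=
  let f n := vdot (repr x n) (repr y n) in
  (limn (fun n => complex.Re (f n)) +i* limn (fun n => complex.Im (f n)))%C.

Definition hnorm (x : hspace) : R := Num.sqrt (complex.Re (hdot x x)).

Fact const_cauchy (u : V) : `[< vcauchy (fun=> u) >].
Proof. by apply/asboolP => e e0; exists 0%N => i j _ _; rewrite subrr vnorm0. Qed.

Definition mu_v (a : event N) : hspace :=
  \pi_hspace (CauchySeq (const_cauchy (chi R a))).

Lemma vdot_chi a b : vdot (chi R a) (chi R b) = decoherence S a b.
Proof.
rewrite /vdot (fsbigTE [fset a]%fset) => [|c ca]; last first.
  rewrite fsbig1 // => d _ /=.
  by move: ca; rewrite in_fset1 => /negbTE ->; rewrite conjC0 !mul0r.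
rewrite big_seq_fset1 (fsbigTE [fset b]%fset) => [|c ca]; last first.
  by move: ca; rewrite in_fset1 /= => /negbTE ->; rewrite mulr0 mul0r.
by rewrite big_seq_fset1 /= !eqxx conjC1 !mul1r.
Qed.

Lemma repr_mu_v a : (fun n => vnorm (repr (mu_v a) n - chi R a)) @ \oo --> (0 : R).
Proof.
have : mu_v a = \pi_hspace (repr (mu_v a)) by rewrite reprK.
by rewrite {1}/mu_v => /eqmodP /=; rewrite cauchy_eqv_sym => /asboolP.
Qed.

Lemma vdotDr u v w : vdot w (u + v) = vdot w u + vdot w v.
Proof.
by rewrite (vdotC (u + v)) vdotDl rmorphD /= -(vdotC u) -(vdotC v).
Qed.

Lemma hdot_mu_v a b : hdot (mu_v a) (mu_v b) = decoherence S a b.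
Proof.
pose x n := repr (mu_v a) n; pose y n := repr (mu_v b) n.
pose e n := vnorm (x n - chi R a) * (vnorm (y n - chi R b) + vnorm (chi R b)) +
            vnorm (chi R a) * vnorm (y n - chi R b).
have e0 : e @ \oo --> (0 : R).
  have -> : 0 = 0 * (0 + vnorm (chi R b)) + vnorm (chi R a) * 0 :> R.
    by rewrite mul0r mulr0 addr0.
  apply: cvgD; apply: cvgM; [exact: repr_mu_v| |exact: cvg_cst|exact: repr_mu_v].
  by apply: cvgD; [exact: repr_mu_v|exact: cvg_cst].
have dE n : `|vdot (x n) (y n) - decoherence S a b| <= (e n)%:C%C.
  have -> : vdot (x n) (y n) - decoherence S a b =
      vdot (x n - chi R a) (y n) + vdot (chi R a) (y n - chi R b).
    have := vdotDl (x n - chi R a) (chi R a) (y n).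
    have := vdotDr (y n - chi R b) (chi R b) (chi R a).
    by rewrite !subrK vdot_chi => -> ->; rewrite addrA addrK.
  rewrite (le_trans (ler_normD _ _)) // /e rmorphD /= lerD ?vdot_le //.
  rewrite (le_trans (vdot_le _ _)) // lecR ler_wpM2l ?vnorm_ge0 //.
  by rewrite (le_trans _ (vnormD _ _)) // subrK.
have eR n : `|complex.Re (vdot (x n) (y n)) - complex.Re (decoherence S a b)| <= e n.
  rewrite -lecR; apply: le_trans (dE n).
  by have := normc_ge_Re (vdot (x n) (y n) - decoherence S a b); rewrite raddfB.
have eI n : `|complex.Im (vdot (x n) (y n)) - complex.Im (decoherence S a b)| <= e n.
  rewrite -lecR; apply: le_trans (dE n).
  rewrite normc_def lecR -sqrtr_sqr ler_wsqrtr //.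
  have -> : complex.Im (vdot (x n) (y n)) - complex.Im (decoherence S a b) =
            complex.Im (vdot (x n) (y n) - decoherence S a b) by rewrite raddfB.
  by rewrite lerDr sqr_ge0.
have lim_e (f : nat -> R) l : (forall n, `|f n - l| <= e n) -> limn f = l.
  move=> fe; apply/cvg_lim => //; apply/subr_cvg0/norm_cvg0P.
  by apply: (squeeze_cvgr _ (cvg_cst (0 : R)) e0); near=> n; rewrite normr_ge0 fe.
rewrite /hdot (lim_e _ _ eR) (lim_e _ _ eI).
by case: (decoherence S a b).
Unshelve. all: by end_near. Qed.

End HistoriesHilbertSpace.

Section TotalVariation.
Variables (R : realType) (N : nat) (S : unitary_system R N).

(* [partition] includes non-emptiness of the blocks; allowing an empty block   *)
(* would only add the term |mu set0|, which is 0 for mu_v.                    *)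
Definition total_var (mu : event N -> hspace S) (a : event N) : \bar R :=
  ereal_sup [set (\sum_(b <- P) hnorm (mu b))%:E |
    P in [set P : {fset event N} | partition [set` P] val (val a)]].

Definition of_bounded_variation (mu : event N -> hspace S) :=
  forall a : event N, (total_var mu a < +oo)%E.

End TotalVariation.

Section Generic.
Variables (R : realType) (N : nat) (S : unitary_system R N).

(* zeta r j is zeta_j(r); recall that step r.-1 is U(r,r-1), r >= 2. *)
Definition zeta (r : nat) (j : 'I_N) : R :=
  (\sum_(i < N) complex.Re `|step S r.-1 i j|) - 1.

Definition zeta_min (r : nat) : R := inf (range (zeta r)).

Definition time_independent := forall k, (1 <= k)%N -> step S k = step S 1.

Definition generic :=
  (time_independent -> forall j, 0 < zeta 2 j) /\
  (~ time_independent ->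
     (forall r, (2 <= r)%N -> 0 < zeta_min r) /\
     (\sum_(2 <= r <oo) (zeta_min r)%:E = +oo)%E).

End Generic.

(* Main.v *)
Require Import Defs.
From mathcomp Require Import all_boot all_order all_algebra.
From mathcomp Require Import finmap complex.
From mathcomp Require Import all_classical all_reals all_analysis.
Set Implicit Arguments.
Unset Strict Implicit.
Unset Printing Implicit Defensive.
Import Order.TTheory GRing.Theory Num.Theory.
Local Open Scope classical_set_scope.
Local Open Scope ring_scope.

(** The norm of the vector measure of a cylinder is the modulus of its
    amplitude, so partitioning the sample space into the cylinders of a given
    length bounds the total variation below by the sum of the moduli of all
    amplitudes of that length. Lengthening the strings by one step multiplies
    each term by [1 + zeta], hence the sum grows at least by the factor
    [1 + zeta_min], and [\prod (1 + zeta_min)] is bounded below by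
    [1 + \sum zeta_min], which diverges. *)

Lemma nneseries_pinfty_unbounded (R : realType) (u : nat -> R) (n : nat) :
  (forall i, (n <= i)%N -> 0 <= u i) ->
  (\sum_(n <= i <oo) (u i)%:E = +oo)%E ->
  forall M : R, exists m, M < \sum_(n <= i < m) u i.
Proof.
move=> u0 uoo M; apply: contrapT => uM.
suff : (\sum_(n <= i <oo) (u i)%:E <= M%:E)%E by rewrite uoo leye_eq.
apply: lime_le.
  by apply: is_cvg_nneseries_cond => i ni _; rewrite lee_fin u0.
apply: nearW => m; rewrite sumEFin lee_fin leNgt.
by apply/negP => Mm; apply: uM; exists m.
Qed.

Lemma Re_normCM (R : rcfType) (x y : R[i]) :
  complex.Re `|x * y| = complex.Re `|x| * complex.Re `|y|.
Proof. by rewrite normrM !normc_def /= mulr0 subr0. Qed.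

Lemma Re_normC_ge0 (R : rcfType) (x : R[i]) : 0 <= complex.Re `|x|.
Proof. by rewrite normc_def sqrtr_ge0. Qed.

Lemma Re_normC_eq0 (R : rcfType) (x : R[i]) :
  (complex.Re `|x| == 0) = (x == 0).
Proof. by rewrite -[RHS]normr_eq0 normc_def eq_complex /= eqxx andbT. Qed.

Section VectorMeasure.
Variables (R : realType) (N : nat) (S : unitary_system R N).

Lemma zeta_min_le r j : zeta_min S r <= zeta S r j.
Proof.
apply: ge_inf; last by exists j.
(* [inf] lies below its members only for a set with a lower bound; sums of moduli are nonnegative,
   so [-1] is one. *)
exists (-1) => _ [i _ <-].
by rewrite /zeta lerDr sumr_ge0 // => k _; exact: Re_normC_ge0.
Qed.

Lemma dimension_gt0 : (0 < N)%N.
Proof.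
have : \sum_s `|init S s 0| ^+ 2 != 0 by rewrite init_unit oner_neq0.
by case: N S => // S0; rewrite big_ord0 eqxx.
Qed.

(** The index set is finite and nonempty, so some [j] attains the minimum and the infimum inherits
    its sign. *)
Lemma zeta_min_gt0 r : (forall j, 0 < zeta S r j) -> 0 < zeta_min S r.
Proof.
move=> z0; pose j0 := Ordinal dimension_gt0.
pose j := [arg min_(i < j0) zeta S r i]%O.
have jmin i : zeta S r j <= zeta S r i by rewrite /j; case: arg_minP => // k _; exact.
apply: lt_le_trans (z0 j) _; apply: lb_le_inf; first by exists (zeta S r j), j.
by move=> _ [i _ <-].
Qed.

(** Merges the two cases of genericity: for a time-independent evolution [zeta_min] is a positive
    constant, so its partial sums grow linearly. *)
Lemma generic_zeta_min : generic S ->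
  (forall r, (2 <= r)%N -> 0 < zeta_min S r) /\
  (forall M : R, exists n, M < \sum_(2 <= r < n) zeta_min S r).
Proof.
case=> gI gD; have [tI|tD] := pselect (time_independent S); last first.
  have [z0 zoo] := gD tD; split=> //; apply: nneseries_pinfty_unbounded zoo => r r2; exact/ltW/z0.
have zE r : (2 <= r)%N -> zeta_min S r = zeta_min S 2.
  case: r => [|[|r]] // _.
  rewrite /zeta_min (_ : zeta S r.+2 = zeta S 2) //.
  by apply/funext => j; rewrite /zeta /= tI.
have z0 := zeta_min_gt0 (gI tI).
(* Starting the sum at 2 leaves exactly [Num.bound] equal terms. *)
split=> [r /zE ->//|M]; exists (Num.bound `|M / zeta_min S 2|).+2.
rewrite big_nat (eq_bigr (fun=> zeta_min S 2)) => [|r /andP[/zE]//].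
rewrite -big_nat sumr_const_nat subn2 /= -mulr_natl -ltr_pdivrMr //.
exact: le_lt_trans (ler_norm _) (archi_boundP (normr_ge0 _)).
Qed.

Definition amplitude_sum m : R :=
  \sum_(g : m.+1.-tuple 'I_N) complex.Re `|amplitude S g|.

(** One-entry strings have the components of the initial vector as amplitudes, and a unit vector is
    nonzero. *)
Lemma amplitude_sum0_gt0 : 0 < amplitude_sum 0.
Proof.
rewrite lt_def sumr_ge0 ?andbT => [|g _]; last exact: Re_normC_ge0.
apply/negP; rewrite psumr_eq0 => [/allP A0|g _]; last exact: Re_normC_ge0.
have := init_unit S; rewrite big1 => [/esym/eqP|s _]; first by rewrite oner_eq0.
have := A0 [tuple s] (mem_index_enum _).
by rewrite Re_normC_eq0 /amplitude big_ord0 mul1r => /eqP ->; rewrite normr0 expr0n.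
Qed.

(** Summing over the appended entry gives the absolute column sum of [step S m.+1] at the last entry
    of [g], which is [1 + zeta S m.+2] there. *)
Lemma amplitude_sumS m :
  amplitude_sum m * (1 + zeta_min S m.+2) <= amplitude_sum m.+1.
Proof.
rewrite /amplitude_sum
  (reindex (fun p : m.+1.-tuple 'I_N * 'I_N => extend p.1 p.2)); last first.
  exists (fun g => (initial g, tnth g ord_max)) => [[g s] _|g _] /=.
    by rewrite initial_extend tnth_extend_max.
  exact: extend_initial.
rewrite -(pair_bigA _ (fun g s => complex.Re `|amplitude S (extend g s)|)).
rewrite mulr_suml; apply: ler_sum => g _.
under eq_bigr do rewrite amplitude_extend Re_normCM.
rewrite -mulr_suml mulrC ler_wpM2r ?Re_normC_ge0 //.
by rewrite addrC -lerBrDr; exact: (zeta_min_le m.+2 (tnth g ord_max)).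
Qed.

Lemma amplitude_sum_ge : (forall r, (2 <= r)%N -> 0 < zeta_min S r) ->
  forall m, amplitude_sum 0 * (1 + \sum_(2 <= r < m.+2) zeta_min S r) <=
            amplitude_sum m.
Proof.
move=> z0; have A0 := amplitude_sum0_gt0.
elim=> [|m IH]; first by rewrite big_geq // addr0 mulr1.
rewrite big_nat_recr //=; apply: le_trans (amplitude_sumS m).
have zm : 0 < zeta_min S m.+2 by exact: z0.
apply: le_trans (ler_wpM2r _ IH); last by rewrite addr_ge0 // ltW.
rewrite -mulrA (ler_wpM2l (ltW A0)) // mulrDr mulr1 addrA lerD2l.
(* What remains is [z <= (1 + s) * z], with [z] the new term and [s] the nonnegative partial sum. *)
rewrite ler_peMl ?(ltW zm) // lerDl big_nat sumr_ge0 // => r /andP[r2 _].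
exact/ltW/z0.
Qed.

Lemma hnorm_cyl m (g : m.+1.-tuple 'I_N) :
  hnorm (mu_v S (cyl_event g)) = complex.Re `|amplitude S g|.
Proof.
rewrite /hnorm hdot_mu_v dec_cyl eqxx mulr1 mulrC -normCK.
by rewrite expr2 -normrM Re_normCM -expr2 sqrtr_sqr ger0_norm // Re_normC_ge0.
Qed.

(** Lets the sum over the set of blocks be reindexed by strings; any history in a cylinder recovers
    its string as a prefix. *)
Lemma cyl_event_inj m : injective (@cyl_event N m).
Proof.
move=> g h /(congr1 val) /= gh; have [w gw] := cyl_nonempty g.
by move: (gw); rewrite gh => /cylP ->; apply/cylP.
Qed.

Lemma events_setT : events (setT : set (history N)).
Proof. by have [] := events_algebra N. Qed.

Definition sure_event : event N := Sub setT (asboolT events_setT).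

Lemma total_var_ge m : ((amplitude_sum m)%:E <= total_var (mu_v S) sure_event)%E.
Proof.
apply: ereal_sup_ubound.
exists [fset cyl_event g | g in [set: m.+1.-tuple 'I_N]%SET]%fset.
  split.
  - apply/seteqP; split=> // w _; exists (cyl_event (prefix_of w m.+1)).
      by rewrite /=; apply/imfsetP; exists (prefix_of w m.+1); rewrite ?inE.
    exact: cyl_prefix_of.
  - by move=> _ _ /imfsetP[g _ ->] /imfsetP[h _ ->] [w [/cylP -> /cylP ->]].
  - by move=> _ /imfsetP[g _ ->]; exact: cyl_nonempty.
rewrite big_imfset /= => [|g h _ _]; last exact: cyl_event_inj.
congr (_%:E).
rewrite big_enum /=.
by apply: eq_big => g; rewrite ?inE // hnorm_cyl.
Qed.

End VectorMeasure.

Theorem claim3 (R : realType) (N : nat) (S : unitary_system R N) :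
  generic S -> ~ of_bounded_variation (mu_v S).
Proof.
move=> /generic_zeta_min[z0 zoo] /(_ (sure_event N)); apply/negP; rewrite -leNgt.
have A0 := amplitude_sum0_gt0 S.
rewrite leye_eq; apply/eqP/eqyP => M M0.
(* The absolute value makes the bound nonnegative, so the partial sum exceeding it cannot be empty
   and [n] is at least 2. *)
have [n zn] := zoo `|M / amplitude_sum S 0|.
have n2 : (2 <= n)%N.
  by rewrite leqNgt; apply/negP => n2; rewrite big_geq ?normr_lt0 // ltnW in zn.
rewrite -(subnK n2) addn2 in zn.
apply: le_trans (total_var_ge S (n - 2)); rewrite lee_fin.
apply: le_trans (amplitude_sum_ge z0 _).
rewrite mulrC -ler_pdivrMr // (le_trans (ler_norm _)) // (le_trans (ltW zn)) //.
by rewrite lerDr.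
Qed.
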